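(* Let $L=\mathbb{Q}(\sqrt{3})$ with ring of integers $O_L$, and let $$f_5(q):=\sum_{n=0}^{\infty}(-1)^n\frac{(q)_n}{(q;q^2)_{n+1}}\,q^{\frac{n^2+n}{2}}.$$ Then $$q\,f_5(q^4)=\sum_{\substack{\mathbf{a}\subset O_L\\ \mathcal{N}(\mathbf{a})\equiv 1\pmod 4}}q^{\mathcal{N}(\mathbf{a})},$$ where the sum runs over the nonzero ideals $\mathbf{a}$ of $O_L$ with $\mathcal{N}(\mathbf{a})\equiv 1\pmod 4$.
   Context: Identities are between formal power series in $q$ (equivalently, for $|q|<1$). Notation: $(a;q)_n:=\prod_{j=0}^{n-1}(1-aq^j)$ and $(a)_n:=(a;q)_n$; thus $(q)_n=\prod_{j=1}^n(1-q^j)$ and $(q;q^2)_n=\prod_{j=0}^{n-1}(1-q^{2j+1})$. For an ideal $\mathbf{a}$ of $O_L$, $\mathcal{N}(\mathbf{a})=|O_L/\mathbf{a}|$ is its norm. *)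

(* Defs.v *)
From HB Require Import structures.
From mathcomp Require Import all_boot all_order all_algebra all_field.
From mathcomp Require Import finmap.
From mathcomp Require Import boolp classical_sets functions cardinality fsbigop.

Set Implicit Arguments.
Unset Strict Implicit.
Unset Printing Implicit Defensive.

Import Order.TTheory GRing.Theory Num.Theory.

Local Open Scope classical_set_scope.
Local Open Scope ring_scope.

Definition is_integral (L : fieldExtType rat) : pred L :=
  fun x => `[< integralOver (intr : int -> L) x >].

Fact is_integral_subring (L : fieldExtType rat) :
  subring_closed (@is_integral L).
Proof.
split=> [|x y /asboolP Ix /asboolP Iy|x y /asboolP Ix /asboolP Iy];
  apply/asboolP.
- exact: integral1.
- exact: integral_sub.
- exact: integral_mul.
Qed.

HB.instance Definition _ (L : fieldExtType rat) :=
  GRing.isSubringClosed.Build L (@is_integral L) (@is_integral_subring L).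

Record ring_of_integers (L : fieldExtType rat) :=
  RingOfIntegers { int_val :> L; _ : is_integral int_val }.

HB.instance Definition _ (L : fieldExtType rat) :=
  [isSub for @int_val L].
HB.instance Definition _ (L : fieldExtType rat) :=
  [Choice of ring_of_integers L by <:].
HB.instance Definition _ (L : fieldExtType rat) :=
  [SubChoice_isSubComNzRing of ring_of_integers L by <:].

Definition is_ideal (R : comPzRingType) (I : set R) : Prop :=
  [/\ I 0, forall x y, I x -> I y -> I (x + y) & forall r x, I x -> I (r * x)].

Definition cosets (R : comPzRingType) (I : set R) : set (set R) :=
  range (fun x : R => [set y | I (y - x)]).

(* [fset_set] is empty on infinite sets, so the norm of an ideal of infinite
   index (such as the zero ideal of a ring of integers) is 0 by convention. *)
Definition ideal_norm (R : comPzRingType) (I : set R) : nat :=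
  #|` fset_set (cosets I)|%fset.

(* A formal power series is the sequence of its coefficients. *)
Definition fps (R : Type) := nat -> R.

Definition fps_of_poly (R : nzRingType) (p : {poly R}) : fps R := fun n => p`_n.

Definition fps_mul (R : nzRingType) (f g : fps R) : fps R :=
  fun n => \sum_(i < n.+1) f i * g (n - i)%N.

Fixpoint fps_inv_coefs (R : comUnitRingType) (f : fps R) (n : nat) : seq R :=
  if n is m.+1 then
    let s := fps_inv_coefs f m in
    rcons s ((f 0)^-1 * ((m == 0)%:R - \sum_(i < m) f (m - i)%N * s`_i))
  else [::].

Definition fps_inv (R : comUnitRingType) (f : fps R) : fps R :=
  fun n => (fps_inv_coefs f n.+1)`_n.

(* f(q) |-> f(q^k), for k > 0 *)
Definition fps_subst_expn (R : nzRingType) (k : nat) (f : fps R) : fps R :=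
  fun n => if (k %| n)%N then f (n %/ k)%N else 0.

(* Convergence of a (possibly infinite) family for the q-adic topology:
   each coefficient receives finitely many nonzero contributions. *)
Definition fps_summable (R : nzRingType) (I : choiceType) (A : set I)
    (F : I -> fps R) : Prop :=
  forall n, finite_set (A `&` [set i | F i n != 0]).

(* Meaningful when the family is summable, as \sum_(i \in A) is 0 when its
   support is infinite. *)
Definition fps_sum (R : nzRingType) (I : choiceType) (A : set I)
    (F : I -> fps R) : fps R :=
  fun n => \sum_(i \in A) F i n.

Definition qpoch (R : nzRingType) (a q : R) (n : nat) : R :=
  \prod_(j < n) (1 - a * q ^+ j).

Definition f5_term (n : nat) : fps int :=
  fps_mul
    (fps_of_poly ((-1) ^+ n * qpoch 'X 'X n * 'X^((n ^ 2 + n) %/ 2)))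
    (fps_inv (fps_of_poly (qpoch 'X ('X^2) n.+1))).

Definition f5 : fps int := fps_sum [set: nat] f5_term.

Lemma size_fps_inv_coefs (R : comUnitRingType) (f : fps R) n :
  size (fps_inv_coefs f n) = n.
Proof. by elim: n => //= n IHn; rewrite size_rcons IHn. Qed.

Lemma nth_fps_inv_coefs (R : comUnitRingType) (f : fps R) n i :
  (i < n)%N -> (fps_inv_coefs f n)`_i = fps_inv f i.
Proof.
elim: n => // n IHn; rewrite ltnS leq_eqVlt => /orP[/eqP-> //|lt_in].
by rewrite /= nth_rcons size_fps_inv_coefs lt_in IHn.
Qed.

Lemma fps_mulV (R : comUnitRingType) (f : fps R) :
  f 0 \is a GRing.unit -> fps_mul f (fps_inv f) = fps_of_poly 1.
Proof.
move=> Uf; apply/funext => n; rewrite /fps_of_poly coef1 /fps_mul.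
rewrite (reindex_inj rev_ord_inj) /= big_ord_recr /= !subSS subnn subn0.
rewrite {2}/fps_inv /= nth_rcons size_fps_inv_coefs ltnn eqxx mulVKr //.
rewrite [X in X + _](_ : _ = \sum_(i < n) f (n - i)%N * (fps_inv_coefs f n)`_i).
  by rewrite addrC subrK.
apply: eq_bigr => i _; rewrite subSS (subKn (ltnW (ltn_ord i))).
by rewrite nth_fps_inv_coefs.
Qed.

Lemma f5_denominator_unit n :
  fps_of_poly (qpoch 'X ('X^2) n.+1 : {poly int}) 0 \is a GRing.unit.
Proof.
rewrite /fps_of_poly -horner_coef0 /qpoch horner_prod big1 ?unitr1 // => j _.
by rewrite hornerD hornerN hornerM hornerX mul0r hornerC subr0.
Qed.

Lemma f5_summable : fps_summable [set: nat] f5_term.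
Proof.
move=> N; apply: (@sub_finite_set _ _ `I_N.+1); last exact: finite_II.
move=> n [_ /=]; apply: contraR; rewrite ltnS -ltnNge => lt_Nn.
apply/eqP/big1 => i _; rewrite /fps_of_poly coefMXn.
suff -> : (i < (n ^ 2 + n) %/ 2)%N by rewrite mul0r.
apply: (leq_ltn_trans (leq_ord i)); apply: (leq_trans lt_Nn).
rewrite leq_divRL // muln2 -addnn leq_add2r.
by case: n {lt_Nn} => // n; rewrite expnS leq_pmulr ?expn_gt0.
Qed.

Lemma Qsqrt3_exists :
  exists (L : fieldExtType rat) (s : L), s ^+ 2 = 3 /\ <<1; s>>%VS = fullv.
Proof.
have [L [LC [[|s []] // [Ds] genL]]] := num_field_exists [:: sqrtC 3].
exists L, s; split; last by rewrite -genL adjoin_seq1.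
by apply: (fmorph_inj LC); rewrite rmorphXn /= Ds sqrtCK rmorph_nat.
Qed.

(* Main.v *)
Require Import Defs.
From HB Require Import structures.
From mathcomp Require Import all_boot all_order all_algebra all_field.
From mathcomp Require Import finmap.
From mathcomp Require Import boolp classical_sets functions cardinality fsbigop.
From mathcomp Require Import ring zify.

(** Both sides count the same thing: for [n = 4 * m + 1], the pairs [(r, d)]
    with [0 <= d <= 2 * r] and
      [m = r * (r + 1) + d * (2 * r + 1 - d) / 2].

    On the analytic side, write [(q)_n] and [(q;q^2)_n] for the two products in
    the definition of [f5].  The sequence [1 / (q;q^2)_{n+1}] is the [beta]
    side of a Bailey pair relative to [a = q] ([bailey_pairE]):
      [1 / (q;q^2)_{n+1} =
         \sum_(r <= n) (-1)^r q^(r(r+1)/2) h_r / ((q)_{n-r} (q)_{n+r+1})],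
      [h_r = \sum_(d <= 2r) q^(d(2r+1-d)/2)].
    Insert this in [f5] and exchange the two sums.  For each [r] the sum over
    [n] is an instance of the q-analogue of Gauss's summation in the limit
    where one parameter is infinite, and equals [(-1)^r q^(r(r+1)/2)]
    ([limit_sum_mod]).  The signs cancel, and
      [f5 = \sum_(r >= 0) q^(r(r+1)) h_r].
    Both steps are proved by telescoping (creative telescoping in [r] for the
    first, in [n] for the second), in an arbitrary commutative ring in which
    the [(q)_k] are invertible.  The second sum is infinite, so it is stopped
    at [n < M] and holds modulo [q^(M(M+1)/2)]; the ring of formal power
    series then turns this congruence into an equality of coefficients.

    On the arithmetic side, the ring of integers is [Z[sqrt 3]]
    ([ring_of_integersP]), which is Euclidean for the absolute value of
    [N(x + y sqrt 3) = x^2 - 3 y^2]; hence every nonzero ideal is principal,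
    and its norm is [|N|] of a generator ([ideal_norm_span]).  As
    [x^2 - 3 y^2 = x^2 + y^2] modulo 4 is never 3, an ideal whose norm is 1
    modulo 4 has generators of positive [N] only.  The powers of the unit
    [2 + sqrt 3] and the sign act on these, and [0 <= 2 y < x] is a fundamental
    domain ([reduced_generator], [reduced_inj]).  Since [N] is odd, so is
    [x - y], and the substitution [x = 2 r + 1 + d], [y = d] turns the domain
    into [0 <= d <= 2 r] and [N] into [4 m + 1] with [m] as above. *)

Set Implicit Arguments.
Unset Strict Implicit.
Unset Printing Implicit Defensive.

Import Order.TTheory GRing.Theory Num.Theory.

Local Open Scope classical_set_scope.
Local Open Scope ring_scope.

(** * A Bailey pair and a Hecke-type double sum *)

Section QSeries.

(* [qinv k] stands for [1 / (q)_k]. *)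
Variables (R : comNzRingType) (q : R) (qinv : nat -> R).
Hypothesis qinvE : forall k, qpoch q q k * qinv k = 1.

Lemma qpochS (a b : R) n : qpoch a b n.+1 = qpoch a b n * (1 - a * b ^+ n).
Proof. by rewrite /qpoch big_ord_recr. Qed.

Lemma qpoch0 (a b : R) : qpoch a b 0 = 1.
Proof. by rewrite /qpoch big_ord0. Qed.

Lemma qinv0 : qinv 0 = 1.
Proof. by have := qinvE 0; rewrite qpoch0 mul1r. Qed.

Lemma qinvS k : qinv k = (1 - q ^+ k.+1) * qinv k.+1.
Proof.
have := qinvE k.+1; rewrite qpochS -exprS => E.
by rewrite -[LHS]mulr1 -[X in _ * X]E !mulrA [qinv k * _]mulrC qinvE mul1r.
Qed.

(** [1 / (q)_{n-r}], with the convention that it vanishes for [r > n]; under this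
    convention the recurrence [qinvbS] also holds at the boundary [r = n], which
    is what makes the telescoping sums below end in 0. *)
Definition qinvb n r := if (r <= n)%N then qinv (n - r) else 0.

Lemma qinvb0 n : qinvb n 0 = qinv n.
Proof. by rewrite /qinvb subn0. Qed.

Lemma qinvb_gt n r : (n < r)%N -> qinvb n r = 0.
Proof. by rewrite /qinvb ltnNge => /negPf->. Qed.

Lemma qinvbSS n r : qinvb n.+1 r.+1 = qinvb n r.
Proof. by []. Qed.

Lemma qinvbS n r : (r <= n)%N -> qinvb n r.+1 = (1 - q ^+ (n - r)) * qinvb n r.
Proof.
rewrite leq_eqVlt => /predU1P[->|ltrn]; first by rewrite qinvb_gt // subnn subrr mul0r.
by rewrite /qinvb ltrn (ltnW ltrn) subnS -[in RHS](@prednK (n - r)) ?subn_gt0 // qinvS.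
Qed.

Lemma binS2 m : 'C(m.+2, 2) = ('C(m.+1, 2) + m.+1)%N.
Proof. by rewrite binS bin1 addnC. Qed.

(** Multiplied by [1 - q^n], the partial sums of [qbin_vanish] have a closed
    form, because
      [(1 - q^n) (1 + q^r) = (1 - q^(n+r)) + q^r (1 - q^(n-r))]. *)
Lemma qbin_telescope n m : (0 < n)%N -> (m <= n)%N ->
  (1 - q ^+ n) * (qinv n * qinv n + \sum_(r < m) (-1) ^+ r.+1 * q ^+ 'C(r.+1, 2) *
     (1 + q ^+ r.+1) * qinvb n r.+1 * qinv (n + r.+1))
  = (-1) ^+ m * q ^+ 'C(m.+1, 2) * qinvb n m.+1 * qinv (n + m).
Proof.
move=> n0; elim: m => [_|m IHm ltmn].
  by rewrite big_ord0 qinvbS // qinvb0 subn0 addr0 addn0; ring.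
rewrite big_ord_recr /= addrA mulrDr IHm ?(ltnW ltmn) //.
rewrite (@qinvbS n m.+1) // addnS (qinvS (n + m)) binS2 !exprD.
have -> : q ^+ n = q ^+ (n - m.+1) * q ^+ m.+1 by rewrite -exprD subnK.
have -> : q ^+ (n + m).+1 = q ^+ (n - m.+1) * q ^+ m.+1 * q ^+ m.+1.
  by rewrite -!exprD; congr (_ ^+ _); lia.
by rewrite [(-1) ^+ m.+1]exprS; ring.
Qed.

(** This is [\sum_(-n <= r <= n) (-1)^r q^(r(r-1)/2) / ((q)_{n-r} (q)_{n+r}) = 0],
    the q-binomial expansion of a product with a zero factor; the terms [r] and
    [- r] are grouped. *)
Lemma qbin_vanish n : (0 < n)%N ->
  qinv n * qinv n + \sum_(r < n) (-1) ^+ r.+1 * q ^+ 'C(r.+1, 2) *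
     (1 + q ^+ r.+1) * qinvb n r.+1 * qinv (n + r.+1) = 0.
Proof.
case: n => // n _; set x := _ + _.
have := @qbin_telescope n.+1 n.+1 isT (leqnn _).
move=> /(congr1 (fun y => y * (qpoch q q n * qinv n.+1))).
rewrite qinvb_gt // !mulr0 !mul0r mulrAC -/x.
have -> : (1 - q ^+ n.+1) * (qpoch q q n * qinv n.+1) = 1.
  by rewrite mulrCA -qinvS qinvE.
by rewrite mul1r.
Qed.

(** The theta-like polynomial [q^(r(r+1)/2) \sum_(-r <= c <= r) q^(-c(c+1)/2)],
    indexed by [d = r - c] so that only nonnegative exponents occur. *)
Definition theta_poly r := \sum_(d < r.*2.+1) q ^+ ((d * (r.*2.+1 - d))./2).

Lemma theta_poly0 : theta_poly 0 = 1.
Proof. by rewrite /theta_poly big_ord1. Qed.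

Lemma theta_polyS r : theta_poly r.+1 = q ^+ r.+1 * theta_poly r + (1 + q ^+ r.+1).
Proof.
rewrite /theta_poly doubleS big_ord_recr big_ord_recl /= expr0.
have -> : ((r.*2.+2 * (r.*2.+3 - r.*2.+2))./2 = r.+1)%N by lia.
rewrite addrAC addrC; congr (_ + _); rewrite mulr_sumr.
apply: eq_bigr => d _; rewrite -exprD; congr (_ ^+ _); rewrite /bump /=.
have -> : ((1 + d) * (r.*2.+3 - (1 + d)) = d * (r.*2.+1 - d) + (r.+1).*2)%N.
  by have := ltn_ord d; nia.
by rewrite halfD odd_double andbF add0n doubleK addnC.
Qed.

(** The [beta] side of the Bailey pair relative to [a = q] whose [alpha] side is
    [(-1)^r q^(r(r+1)/2) h_r / (1 - q)]. *)
Definition bailey_pair n :=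
  \sum_(r < n.+1) (-1) ^+ r * q ^+ 'C(r.+1, 2) * theta_poly r *
    qinvb n r * qinv (n + r).+1.

Lemma bailey_pair0 : bailey_pair 0 = qinv 1.
Proof. by rewrite /bailey_pair big_ord1 theta_poly0 qinvb0 qinv0; ring. Qed.

(** Let [w_r = (-1)^r q^(r^2) / ((q)_{N-r} (q)_{N+r})] and
    [t_r = q^(-r(r+1)/2) h_r] (with [N = n + 1]).  The identity
      [1 - q^(2N+1) - (1 - q^(N-r)) (1 - q^(N+r+1)) =
         q^N (q^(-r) (1 - q^(N+r+1)) + q^(r+1) (1 - q^(N-r)))]
    makes the summand on the left equal to [q^N t_r (w_r - w_{r+1})], and
    summation by parts leaves the sum of [qbin_vanish], as [t_r - t_{r-1}] is
    [q^(-r(r-1)/2) + q^(-r(r+1)/2)]. *)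
Lemma bailey_pair_telescope n m : (m <= n.+1)%N ->
  \sum_(r < m.+1) (-1) ^+ r * q ^+ 'C(r.+1, 2) * theta_poly r *
    ((1 - q ^+ n.+1.*2.+1) * (qinvb n.+1 r * qinv (n.+1 + r).+1) -
     qinvb n.+1 r.+1 * qinv (n.+1 + r))
  = q ^+ n.+1 * (qinv n.+1 * qinv n.+1 + (\sum_(r < m) (-1) ^+ r.+1 *
       q ^+ 'C(r.+1, 2) * (1 + q ^+ r.+1) * qinvb n.+1 r.+1 * qinv (n.+1 + r.+1))
     + (-1) ^+ m * theta_poly m * q ^+ 'C(m.+2, 2) * qinvb n.+1 m.+1 *
       qinv (n.+1 + m.+1)).
Proof.
set N := n.+1; elim: m => [_|m IHm ltmn].
  rewrite big_ord1 big_ord0 theta_poly0 qinvbS // subn0 qinvb0 !addn0 addn1.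
  rewrite (qinvS N) -addnn.
  by rewrite [q ^+ (N + N).+1]exprS exprD [q ^+ N.+1]exprS; ring.
rewrite big_ord_recr IHm ?(ltnW ltmn) // [in RHS]big_ord_recr /=.
rewrite (@qinvbS N m.+1) // (addnS N m.+1) (qinvS (N + m.+1)) theta_polyS !binS2 !exprD.
rewrite [(-1) ^+ m.+1]exprS [q ^+ m.+2]exprS.
have -> : q ^+ N.*2.+1 = q * q ^+ N * q ^+ N.
  by rewrite -addnn exprS exprD mulrA.
have -> : q ^+ (N + m.+1).+1 = q * q ^+ N * q ^+ m.+1 by rewrite exprS exprD mulrA.
have -> : q ^+ N = q ^+ (N - m.+1) * q ^+ m.+1 by rewrite -exprD subnK.
by ring.
Qed.

Lemma bailey_pairS n : (1 - q ^+ n.+1.*2.+1) * bailey_pair n.+1 = bailey_pair n.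
Proof.
apply/eqP; rewrite -subr_eq0; apply/eqP.
have -> : bailey_pair n = \sum_(r < n.+2) (-1) ^+ r * q ^+ 'C(r.+1, 2) * theta_poly r *
    (qinvb n.+1 r.+1 * qinv (n.+1 + r)).
  rewrite big_ord_recr /= qinvb_gt // mul0r mulr0 addr0.
  by apply: eq_bigr => r _; rewrite mulrA.
rewrite mulr_sumr -sumrB.
have := @bailey_pair_telescope n n.+1 (leqnn _).
rewrite qbin_vanish // qinvb_gt // mulr0 mul0r addr0 mulr0 => {}E.
by rewrite -[RHS]E; apply: eq_bigr => r _; rewrite addSn; ring.
Qed.

Lemma bailey_pairE n : qpoch q (q ^+ 2) n.+1 * bailey_pair n = 1.
Proof.
elim: n => [|n IHn].
  by rewrite bailey_pair0 qpochS qpoch0 mul1r expr0 mulr1 -[q]expr1 -qinvS qinv0.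
by rewrite qpochS -exprM -exprS mul2n -mulrA bailey_pairS.
Qed.

(** The inner sum over [n] obtained by inserting the Bailey pair in [f5]. *)
Definition limit_sum M r := \sum_(n < M)
  (-1) ^+ n * q ^+ 'C(n.+1, 2) * qpoch q q n * qinvb n r * qinv (n + r).+1.

Lemma limit_sum0 M : limit_sum M 0 = 1 - (-1) ^+ M * q ^+ 'C(M.+1, 2) * qinv M.
Proof.
elim: M => [|M IHM]; first by rewrite /limit_sum big_ord0 qinv0 expr0; ring.
rewrite /limit_sum big_ord_recr -/(limit_sum M 0) IHM /= addn0 qinvb0 binS2 exprD.
rewrite -[(-1) ^+ M * _ * _ * _]mulrA qinvE mulr1 (qinvS M) [(-1) ^+ M.+1]exprS; ring.
Qed.

(** The summand [e n r] satisfies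
    [e n r.+1 + q^(r+1) e n r = K (n+1) r - K n r] with
    [K n r = - (1 + q^(r+1)) (1 - q^(n-r)) e n r]. *)
Lemma limit_sumS M r : limit_sum M r.+1 = - (q ^+ r.+1 * limit_sum M r) -
  (1 + q ^+ r.+1) * (-1) ^+ M * q ^+ 'C(M.+1, 2) * qpoch q q M *
  qinvb M r.+1 * qinv (M + r).+1.
Proof.
elim: M => [|M IHM]; first by rewrite /limit_sum !big_ord0 qinvb_gt //; ring.
rewrite /limit_sum 2!big_ord_recr -/(limit_sum M r) -/(limit_sum M r.+1) IHM /=.
rewrite qinvbSS addnS addSn (qinvS (M + r).+1).
have [lerM | ltMr] := leqP r M; last by rewrite !qinvb_gt // 1?ltnW //; ring.
rewrite qinvbS // binS2 exprD qpochS [(-1) ^+ M.+1]exprS.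
have -> : q ^+ (M + r).+2 = q ^+ (M - r) * q ^+ r.+1 * q ^+ r.+1.
  by rewrite -!exprD; congr (_ ^+ _); lia.
have -> : q * q ^+ M = q ^+ (M - r) * q ^+ r.+1.
  by rewrite -exprS -exprD; congr (_ ^+ _); lia.
have -> : q ^+ M.+1 = q ^+ (M - r) * q ^+ r.+1.
  by rewrite -exprD; congr (_ ^+ _); lia.
by ring.
Qed.

(** As [M] grows the sum tends q-adically to [(-1)^r q^(r(r+1)/2)]; the
    remainder is explicit at [r = 0] and is propagated by [limit_sumS]. *)
Lemma limit_sum_mod M r :
  exists x, limit_sum M r = (-1) ^+ r * q ^+ 'C(r.+1, 2) + q ^+ 'C(M.+1, 2) * x.
Proof.
elim: r => [|r [x IHr]].
  exists (- ((-1) ^+ M * qinv M)).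
  by rewrite limit_sum0 (bin_small (_ : 1 < 2)%N) //; ring.
exists (- (q ^+ r.+1 * x) - (1 + q ^+ r.+1) * (-1) ^+ M * qpoch q q M *
  qinvb M r.+1 * qinv (M + r).+1).
by rewrite limit_sumS IHr binS2 exprD [(-1) ^+ r.+1]exprS; ring.
Qed.

Lemma hecke_sum (v : nat -> R) M :
  (forall n, qpoch q (q ^+ 2) n.+1 * v n = 1) ->
  exists x, \sum_(n < M) (-1) ^+ n * qpoch q q n * q ^+ 'C(n.+1, 2) * v n =
    \sum_(r < M) q ^+ (r * r.+1) * theta_poly r + q ^+ 'C(M.+1, 2) * x.
Proof.
move=> vE.
have {vE} vE n : v n = bailey_pair n.
  by rewrite -[RHS]mul1r -(vE n) mulrAC bailey_pairE mul1r.
have /fin_all_exists[x xE] (r : 'I_M) := limit_sum_mod M r.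
exists (\sum_(r < M) (-1) ^+ r * q ^+ 'C(r.+1, 2) * theta_poly r * x r).
transitivity (\sum_(r < M) (-1) ^+ r * q ^+ 'C(r.+1, 2) * theta_poly r * limit_sum M r).
  transitivity (\sum_(n < M) \sum_(r < M) (-1) ^+ n * qpoch q q n *
     q ^+ 'C(n.+1, 2) * ((-1) ^+ r * q ^+ 'C(r.+1, 2) * theta_poly r * qinvb n r *
     qinv (n + r).+1)).
    apply: eq_bigr => n _; rewrite vE -mulr_sumr /bailey_pair; congr (_ * _).
    rewrite (big_ord_widen M (fun r => (-1) ^+ r * q ^+ 'C(r.+1, 2) * theta_poly r *
      qinvb n r * qinv (n + r).+1) (ltn_ord n)) big_mkcond /=.
    by apply: eq_bigr => r _; case: ltnP => // ltnr; rewrite qinvb_gt //; ring.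
  rewrite exchange_big; apply: eq_bigr => r _; rewrite /limit_sum [RHS]mulr_sumr.
  by apply: eq_bigr => n _; ring.
(* The sign and the factor q^(r(r+1)/2) of the pair meet those of the inner sum. *)
rewrite mulr_sumr -big_split; apply: eq_bigr => r _ /=; rewrite xE mulrDr.
have -> : (r * r.+1 = 'C(r.+1, 2) + 'C(r.+1, 2))%N.
  by rewrite addnn -mul2n -(mul_bin_diag r.+1 1) bin1 mulnC.
rewrite exprD; congr (_ + _); last by ring.
have := sqrr_sign R r; rewrite expr2.
by set e := (-1) ^+ r => ee; rewrite -[RHS]mul1r -ee; ring.
Qed.

End QSeries.

(** * The ring of formal power series *)

Section FpsRing.
Variable R : comNzRingType.
Implicit Types f g h : fps R.

(** Coefficients of a product only involve finitely many coefficients of the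
    factors, so that ring laws can be transported from polynomials. *)
Definition fps_trunc N f : {poly R} := \poly_(i < N) f i.

Lemma fps_mul_trunc N f g n : (n < N)%N ->
  fps_mul f g n = (fps_trunc N f * fps_trunc N g)`_n.
Proof.
move=> ltnN; rewrite coefM; apply: eq_bigr => i _.
have := ltn_ord i; rewrite ltnS => lein; rewrite !coef_poly.
by rewrite (leq_ltn_trans lein ltnN) (leq_ltn_trans (leq_subr _ _) ltnN).
Qed.

Let add f g : fps R := fun n => f n + g n.
Let opp f : fps R := fun n => - f n.

Fact fps_mulA : associative (@fps_mul R).
Proof.
move=> f g h; apply/funext => n.
transitivity ((fps_trunc n.+1 f * (fps_trunc n.+1 g * fps_trunc n.+1 h))`_n).
  rewrite coefM; apply: eq_bigr => i _; rewrite coef_poly ltn_ord.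
  by rewrite -fps_mul_trunc // ltnS leq_subr.
rewrite mulrA coefM; apply: eq_bigr => i _.
rewrite [(fps_trunc _ h)`__]coef_poly ltnS leq_subr.
by rewrite -fps_mul_trunc.
Qed.

Fact fps_mulC : commutative (@fps_mul R).
Proof.
by move=> f g; apply/funext => n; rewrite !(@fps_mul_trunc n.+1) // mulrC.
Qed.

Fact fps_mul1 : left_id (fps_of_poly 1) (@fps_mul R).
Proof.
move=> f; apply/funext => n; rewrite /fps_mul big_ord_recl subn0.
rewrite /fps_of_poly coef1 mul1r big1 ?addr0 // => i _.
by rewrite coef1 mul0r.
Qed.

Fact fps_mulDl : left_distributive (@fps_mul R) add.
Proof.
move=> f g h; apply/funext => n; rewrite /add /fps_mul -big_split.
by apply: eq_bigr => i _; rewrite mulrDl.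
Qed.

Fact fps_addA : associative add.
Proof. by move=> f g h; apply/funext => n; rewrite /add addrA. Qed.
Fact fps_addC : commutative add.
Proof. by move=> f g; apply/funext => n; rewrite /add addrC. Qed.
Fact fps_add0 : left_id (fps_of_poly 0) add.
Proof. by move=> f; apply/funext => n; rewrite /add /fps_of_poly coef0 add0r. Qed.
Fact fps_addN : left_inverse (fps_of_poly 0) opp add.
Proof.
by move=> f; apply/funext => n; rewrite /add /opp /fps_of_poly coef0 addNr.
Qed.
Fact fps_1neq0 : fps_of_poly (1 : {poly R}) != fps_of_poly 0 :> {classic nat -> R}.
Proof.
apply/eqP => /(congr1 (fun f => f 0)); rewrite /fps_of_poly coef1 coef0 => /eqP.
by rewrite oner_eq0.
Qed.

HB.instance Definition _ := Choice.copy (fps R) {classic nat -> R}.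
HB.instance Definition _ := GRing.isZmodule.Build (fps R)
  fps_addA fps_addC fps_add0 fps_addN.
HB.instance Definition _ := GRing.Zmodule_isComNzRing.Build (fps R)
  fps_mulA fps_mulC fps_mul1 fps_mulDl fps_1neq0.

Lemma fpsD f g n : (f + g : fps R) n = f n + g n. Proof. by []. Qed.
Lemma fpsM f g : f * g = fps_mul f g. Proof. by []. Qed.

Fact fps_of_poly_zmod_morphism : zmod_morphism (@fps_of_poly R).
Proof. by move=> p r; apply/funext => n; rewrite /fps_of_poly coefB. Qed.
Fact fps_of_poly_monoid_morphism : monoid_morphism (@fps_of_poly R).
Proof. by split=> // p r; apply/funext => n; rewrite /fps_of_poly coefM. Qed.

HB.instance Definition _ := GRing.isZmodMorphism.Build {poly R} (fps R)
  (@fps_of_poly R) fps_of_poly_zmod_morphism.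
HB.instance Definition _ := GRing.isMonoidMorphism.Build {poly R} (fps R)
  (@fps_of_poly R) fps_of_poly_monoid_morphism.

(** A name for the coefficient map, on which to hang its additivity. *)
Definition fps_coef n f : R := f n.
Fact fps_coef_zmod_morphism n : zmod_morphism (fps_coef n).
Proof. by []. Qed.
HB.instance Definition _ n := GRing.isZmodMorphism.Build (fps R) R
  (fps_coef n) (fps_coef_zmod_morphism n).
Lemma fps_sumE (I : Type) (s : seq I) (P : pred I) (F : I -> fps R) n :
  (\sum_(i <- s | P i) F i : fps R) n = \sum_(i <- s | P i) F i n.
Proof. exact: (raddf_sum (fps_coef n)). Qed.

Lemma fpsXnM k f n : (n < k)%N -> (fps_of_poly 'X^k * f : fps R) n = 0.
Proof.
move=> ltnk; rewrite fpsM /fps_mul big1 // => i _.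
by rewrite /fps_of_poly coefXn ltn_eqF ?mul0r // (leq_trans (ltn_ord i)).
Qed.

End FpsRing.

(** Stopping at [M = m + 1] is enough for the coefficient of [q^m], since the
    error term of [hecke_sum] has order [M(M+1)/2 > m]. *)
Lemma f5_coef m : f5 m = \sum_(r < m.+1) \sum_(d < r.*2.+1)
  (m == (r * r.+1 + (d * (r.*2.+1 - d))./2)%N)%:R.
Proof.
have -> : f5 m = \sum_(n < m.+1) f5_term n m.
  rewrite /f5 /fps_sum (@fsbig_ord _ _ _ _ (f5_term ^~ m)).
  apply/esym/fsbig_widen => // n [_ /=].
  move=> /negP; rewrite -leqNgt => lt_mn.
  apply: big1 => i _; rewrite /fps_of_poly coefMXn.
  suff -> : (i < (n ^ 2 + n) %/ 2)%N by rewrite mul0r.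
  apply: (leq_ltn_trans (leq_ord i)); apply: (leq_trans lt_mn).
  by rewrite leq_divRL //; nia.
pose q : fps int := fps_of_poly 'X.
pose qinv k : fps int := fps_inv (fps_of_poly (qpoch 'X 'X k)).
pose v n : fps int := fps_inv (fps_of_poly (qpoch 'X ('X^2) n.+1)).
have qX k : q ^+ k = fps_of_poly 'X^k by rewrite rmorphXn.
have qpochq a b k : fps_of_poly (qpoch a b k) =
    qpoch (fps_of_poly a) (fps_of_poly b) k :> fps int.
  rewrite /qpoch rmorph_prod; apply: eq_bigr => j _.
  by rewrite rmorphB rmorphM rmorphXn rmorph1.
have qinvE k : qpoch q q k * qinv k = 1.
  rewrite -qpochq; apply: fps_mulV.
  rewrite /fps_of_poly -horner_coef0 /qpoch horner_prod big1 ?unitr1 // => j _.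
  by rewrite hornerD hornerN hornerM hornerX mul0r hornerC subr0.
have vE n : qpoch q (q ^+ 2) n.+1 * v n = 1.
  rewrite -rmorphXn -qpochq; apply: fps_mulV; exact: f5_denominator_unit.
have [x] := hecke_sum qinvE m.+1 vE.
move=> /(congr1 (fun f : fps int => f m)).
rewrite fpsD !fps_sumE qX fpsXnM ?addr0; last first.
  by rewrite binS bin1; lia.
move=> E; transitivity (\sum_(i < m.+1)
   ((-1) ^+ i * qpoch q q i * q ^+ 'C(i.+1, 2) * v i : fps int) m).
  apply: eq_bigr => n _; rewrite /f5_term -fpsM; congr ((_ * _ : fps int) _).
  have -> : ((n ^ 2 + n) %/ 2 = 'C(n.+1, 2))%N.
    by rewrite bin2 /= divn2; congr (_./2); lia.
  by rewrite !rmorphM !rmorphXn rmorphN rmorph1; congr (_ * _ * _); exact: qpochq.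
rewrite {}E; apply: eq_bigr => r _.
rewrite /theta_poly mulr_sumr fps_sumE; apply: eq_bigr => d _.
by rewrite -exprD qX /fps_of_poly coefXn.
Qed.

(** * Arithmetic of Z[sqrt 3] *)

(** The 3-adic valuations of the two sides have different parities. *)
Lemma sqr_eq3sqr (a b : int) : a ^+ 2 = 3 * b ^+ 2 -> b = 0.
Proof.
move=> E; apply/eqP; rewrite -absz_eq0; apply/negPn/negP => b0.
have {}E : (`|a| ^ 2 = 3 * `|b| ^ 2)%N.
  by have := congr1 absz E; rewrite abszM !abszX.
have b0' : (0 < `|b|)%N by rewrite lt0n.
have := congr1 (logn 3) E; rewrite lognM ?expn_gt0 ?b0' // !lognX (@logn_prime 3 3) //.
by move=> /(congr1 odd); rewrite oddD !oddM.
Qed.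

(** The norm of [x + y sqrt 3]. *)
Definition qnorm (x y : int) : int := x ^+ 2 - 3 * y ^+ 2.

Lemma qnormM x y u v :
  qnorm (x * u + 3 * (y * v)) (x * v + y * u) = qnorm x y * qnorm u v.
Proof. by rewrite /qnorm; ring. Qed.

Lemma qnorm_eq0 x y : qnorm x y = 0 -> x = 0 /\ y = 0.
Proof.
move=> /eqP; rewrite subr_eq0 => /eqP E; have y0 := sqr_eq3sqr E; split=> //.
by apply/eqP; rewrite -sqrf_eq0 E y0.
Qed.

Lemma round_div (a n : int) : n != 0 ->
  exists k r, a = k * n + r /\ 2 * `|r| <= `|n|.
Proof.
move=> n0; have := divz_eq a n; have := modz_ge0 a n0; have := ltz_mod a n0.
set k := (a %/ n)%Z; set r := (a %% n)%Z => ltr ge0 E.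
have [h|h] := lerP (2 * r) `|n|; first by exists k, r; split; lia.
case: (ltrgt0P n) n0 => // [n_gt0|n_lt0] _ in ltr h.
  by exists (k + 1), (r - n); split; lia.
by exists (k - 1), (r + n); split; lia.
Qed.

(** With remainders at most half of the divisor, [r^2 - 3 t^2] lies between
    [- 3 n^2 / 4] and [n^2 / 4]; this is why [Z[sqrt 3]] is Euclidean. *)
Lemma qnorm_lt_sqr (r t n : int) : 0 < `|n| ->
  2 * `|r| <= `|n| -> 2 * `|t| <= `|n| -> `|qnorm r t| < `|n| * `|n|.
Proof.
have sqr4 (z m : int) : 2 * `|z| <= m -> 0 <= z * z /\ 4 * (z * z) <= m * m.
  move=> le; split; first by nia.
  have : 0 <= (m - 2 * z) * (m + 2 * z) by apply: mulr_ge0; lia.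
  by lia.
move=> n0 /sqr4[r0 r2] /sqr4[t0 t2]; have := mulr_gt0 n0 n0.
by rewrite /qnorm; lia.
Qed.

(** Euclidean division of [a + b sqrt 3] by [x + y sqrt 3]: round the
    coordinates of [(a + b sqrt 3) (x - y sqrt 3) / N(x + y sqrt 3)]. *)
Lemma qnorm_euclid a b x y : qnorm x y != 0 -> exists u v,
  `|qnorm (a - (u * x + 3 * (v * y))) (b - (u * y + v * x))| < `|qnorm x y|.
Proof.
move=> n0; set n := qnorm x y in n0 *.
have [u [r [Er r2]]] := round_div (a * x - 3 * (b * y)) n0.
have [v [t [Et t2]]] := round_div (b * x - a * y) n0.
exists u, v; set A := a - _; set B := b - _.
have E1 : A * x - 3 * (B * y) = r.
  apply: (@addrI _ (u * n)); rewrite -Er /A /B /n /qnorm; ring.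
have E2 : B * x - A * y = t.
  apply: (@addrI _ (v * n)); rewrite -Et /A /B /n /qnorm; ring.
have E : qnorm A B * n = r ^+ 2 - 3 * t ^+ 2.
  by rewrite -E1 -E2 /n /qnorm; ring.
have n_gt0 : 0 < `|n| by rewrite normr_gt0.
rewrite -(ltr_pM2r n_gt0) -normrM E -normrM normrM.
exact: qnorm_lt_sqr.
Qed.

Section QuadraticRing.
(* The ring [O] is [Z[sqrt 3]], known through the coordinates of its elements
   in the basis [1, S]. *)
Variables (O : comNzRingType) (S : O).
Hypothesis S2 : S ^+ 2 = 3.
Let el (x y : int) : O := x%:~R + y%:~R * S.
Hypothesis elP : forall z, exists x y, z = el x y.
Hypothesis el_inj : forall x y u v, el x y = el u v -> x = u /\ y = v.

Lemma elD x y u v : el x y + el u v = el (x + u) (y + v).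
Proof. by rewrite /el; ring. Qed.

Lemma elB x y u v : el x y - el u v = el (x - u) (y - v).
Proof. by rewrite /el; ring. Qed.

Lemma elM x y u v : el x y * el u v = el (x * u + 3 * (y * v)) (x * v + y * u).
Proof. by rewrite /el; ring: S2. Qed.

Definition span x y : set O := [set z | exists w, z = w * el x y].

Lemma spanP u v x y : span x y (el u v) <->
  exists s t, u = s * x + 3 * (t * y) /\ v = s * y + t * x.
Proof.
split=> [[w]|[s [t [-> ->]]]]; last by exists (el s t); rewrite elM.
by have [s [t ->]] := elP w; rewrite elM => /el_inj[-> ->]; exists s, t.
Qed.

Lemma span_ideal x y : is_ideal (span x y).
Proof.
split; first by exists 0; rewrite mul0r.
  by move=> _ _ [u ->] [v ->]; exists (u + v); rewrite mulrDl.
by move=> r _ [u ->]; exists (r * u); rewrite mulrA.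
Qed.

Lemma el0 : el 0 0 = 0. Proof. by rewrite /el; ring. Qed.

Lemma span_norm_neq0 x y : qnorm x y != 0 -> span x y <> [set 0].
Proof.
move=> n0 E; have : [set 0] (el x y) by rewrite -E; exists 1; rewrite mul1r.
by rewrite /= -el0 => /el_inj[x0 y0]; move: n0; rewrite x0 y0.
Qed.

Lemma ideal_principal (I : set O) : is_ideal I -> I <> [set 0] ->
  exists x y, qnorm x y != 0 /\ I = span x y.
Proof.
move=> [I0 ID IM] In0.
pose P n := `[< exists x y, [/\ I (el x y), qnorm x y != 0 & `|qnorm x y|%N = n] >].
have exP : exists n, P n.
  apply: contrapT => nP; apply: In0; apply/seteqP; split=> [z Iz|_ -> //].
  apply: contrapT => z0; apply: nP; have [x [y zE]] := elP z.
  exists `|qnorm x y|%N; apply/asboolP; exists x, y; split=> //.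
    by rewrite -zE.
  by apply/eqP => /qnorm_eq0[x0 y0]; apply: z0; rewrite zE x0 y0 /= el0.
case: (ex_minnP exP) => _ /asboolP[x [y [Ixy n0 <-]]] min_n.
exists x, y; split=> //; apply/seteqP; split=> [z Iz|_ [w ->]]; last exact: IM.
have [a [b zE]] := elP z; have [u [v lt_n]] := qnorm_euclid a b n0.
move: lt_n; set A := a - _; set B := b - _ => lt_n.
have zEE : z = el A B + el u v * el x y by rewrite zE elM elD /A /B; congr (el _ _); ring.
have IAB : I (el A B).
  have -> : el A B = z + (- el u v) * el x y by rewrite zEE; ring.
  by apply: ID => //; apply: IM.
have [/qnorm_eq0[A0 B0]|n1] := eqVneq (qnorm A B) 0.
  by exists (el u v); rewrite zEE A0 B0 el0 add0r.
suff : (`|qnorm x y| <= `|qnorm A B|)%N by lia.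
by apply: min_n; apply/asboolP; exists A, B.
Qed.

(** The hypotheses say that [(a, 0)] and [(b, c)] form a basis of the lattice
    [I] (a Hermite normal form), so that the [i + j S] with [i < a] and [j < c]
    represent each class modulo [I] once. *)
Lemma ideal_norm_basis (I : set O) (a c : nat) b : is_ideal I ->
  (0 < a)%N -> (0 < c)%N ->
  (forall u v, I (el u v) -> (c%:Z %| v)%Z) ->
  (forall u, I (el u 0) <-> (a%:Z %| u)%Z) ->
  I (el b c%:Z) -> ideal_norm I = (a * c)%N.
Proof.
move=> [I0 ID IM] a0 c0 H1 H2 Ib.
have IN z : I z -> I (- z) by move=> Iz; rewrite -mulN1r; apply: IM.
(* The pair (i, j) is encoded as k = j * a + i. *)
pose rep (k : nat) := el (k %% a)%N (k %/ a)%N.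
pose f (k : nat) : set O := [set y | I (y - rep k)].
rewrite /ideal_norm; apply: card_fset_set.
have -> : cosets I = f @` `I_(a * c).
  apply/seteqP; split=> [_ [z _ <-]|_ [k _ <-]]; last by exists (rep k).
  have [u [v zE]] := elP z.
  pose u' := u - (v %/ c%:Z)%Z * b.
  have a1 : a%:Z != 0 by lia.
  have c1 : c%:Z != 0 by lia.
  have [i iE] : exists i : nat, (u' %% a%:Z)%Z = i.
    by exists `|(u' %% a%:Z)%Z|%N; rewrite gez0_abs // modz_ge0.
  have [j jE] : exists j : nat, (v %% c%:Z)%Z = j.
    by exists `|(v %% c%:Z)%Z|%N; rewrite gez0_abs // modz_ge0.
  have ltia : (i < a)%N by rewrite -ltz_nat -iE ltz_pmod.
  have ltjc : (j < c)%N by rewrite -ltz_nat -jE ltz_pmod.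
  exists (j * a + i)%N => /=; first by nia.
  have Iz : I (z - rep (j * a + i)%N).
    rewrite /rep divnMDl // modnMDl divn_small // modn_small // addn0 zE elB.
    have -> : el (u - i%:Z) (v - j%:Z) =
        el (v %/ c%:Z)%Z 0 * el b c%:Z + el ((u' %/ a%:Z)%Z * a) 0.
      rewrite elM elD; congr (el _ _); last by rewrite [X in X - _](divz_eq v c) jE; ring.
      have E : u - (v %/ c)%Z * b = (u' %/ a)%Z * a + i%:Z by rewrite -iE -divz_eq.
      by move: (u' %/ a)%Z (v %/ c)%Z E => m1 m2 E; lia.
    by apply: ID; [apply: IM | apply/H2/dvdz_mull].
  apply/seteqP; split=> y /= Iy.
    have -> : y - z = (y - rep (j * a + i)%N) + - (z - rep (j * a + i)%N) by ring.
    by apply: ID => //; apply: IN.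
  rewrite -[f _ y]/(I (y - rep (j * a + i)%N)).
  have -> : y - rep (j * a + i)%N = (y - z) + (z - rep (j * a + i)%N) by ring.
  exact: ID.
apply: inj_card_eq => k l; rewrite !inE /= => ltk ltl fE.
have : I (rep k - rep l).
  by have /(congr1 (fun A : set O => A (rep k))) := fE; rewrite /f /= subrr => <-.
rewrite elB => Ikl; have := H1 _ _ Ikl => /dvdzP[m mE].
have ltka : (k %/ a < c)%N by rewrite ltn_divLR // mulnC.
have ltla : (l %/ a < c)%N by rewrite ltn_divLR // mulnC.
have m0 : m = 0 by nia.
have kl : (k %/ a = l %/ a)%N by apply/eqP; rewrite -eqz_nat -subr_eq0 mE m0 mul0r.
move: Ikl; rewrite kl subrr => /H2/dvdzP[m' m'E].
have := ltn_pmod k a0; have := ltn_pmod l a0 => h1 h2.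
have m'0 : m' = 0 by nia.
rewrite (divn_eq k a) (divn_eq l a) kl; congr (_ + _)%N.
by apply/eqP; rewrite -eqz_nat -subr_eq0 m'E m'0 mul0r.
Qed.

(** With [g = gcd(x, y)], the second coordinates of the elements of the ideal
    are the multiples of [g], and its elements of second coordinate 0 are the
    multiples of [N(x + y S) / g]. *)
Lemma ideal_norm_span x y : qnorm x y != 0 ->
  ideal_norm (span x y) = `|qnorm x y|%N.
Proof.
move=> n0; have [q [p pq]] := Bezoutz x y.
have g0 : gcdz x y != 0.
  by apply: contraNneq n0 => /eqP; rewrite gcdz_eq0 => /andP[/eqP-> /eqP->].
have /dvdzP[x' xE] := dvdz_gcdl x y; have /dvdzP[y' yE] := dvdz_gcdr x y.
have [g gE] : exists g : nat, gcdz x y = g by exists (gcdn `|x| `|y|).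
rewrite gE in pq xE yE g0.
have pq1 : q * x' + p * y' = 1.
  by apply: (mulIf g0); rewrite mul1r -[RHS]pq xE yE; ring.
have nE : qnorm x y = g%:Z * g%:Z * qnorm x' y' by rewrite xE yE /qnorm; ring.
have n0' : qnorm x' y' != 0.
  by apply: contraNneq n0 => E; rewrite nE E mulr0.
have -> : `|qnorm x y|%N = (g * `|qnorm x' y'| * g)%N by rewrite nE !abszM; lia.
apply: (@ideal_norm_basis _ _ _ (p * x + 3 * (q * y))).
- exact: span_ideal.
- by rewrite muln_gt0; lia.
- by lia.
- move=> u v /spanP[s [t [_ ->]]]; rewrite xE yE !mulrA -mulrDl.
  exact: dvdz_mull.
- move=> u; split=> [/spanP[s [t [uE vE]]]|/dvdzP[k ->]].
    have st : s * y' + t * x' = 0.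
      by apply: (mulIf g0); rewrite mul0r vE xE yE; ring.
    have sE : s = x' * (q * s - p * t).
      by rewrite -[LHS]mulr1 -pq1 -[RHS]addr0 -(mulr0 p) -st; ring.
    have tE : t = - y' * (q * s - p * t).
      by rewrite -[LHS]mulr1 -pq1 -[RHS]addr0 -(mulr0 q) -st; ring.
    have -> : u = (q * s - p * t) * (g%:Z * qnorm x' y').
      by move: (q * s - p * t) sE tE => k sE tE; rewrite uE sE tE xE yE /qnorm; ring.
    by rewrite dvdz_mull // dvdzE !abszM.
  have [e eE] : exists e : int, `|qnorm x' y'|%N = e * qnorm x' y' :> int.
    by have [h|h] := leP 0 (qnorm x' y'); [exists 1 | exists (-1)]; lia.
  apply/spanP; exists (k * e * x'), (- (k * e * y')); split.
    by rewrite PoszM eE /qnorm xE yE; ring.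
  by rewrite xE yE; ring.
apply/spanP; exists p, q; split; first by [].
by rewrite -pq; ring.
Qed.


(** Elements of norm 1 are units, with inverse the conjugate [s - t S]. *)
Lemma span_unit s t x y : qnorm s t = 1 ->
  span (s * x + 3 * (t * y)) (s * y + t * x) = span x y.
Proof.
move=> st1; rewrite /span -elM.
have inv : el s (- t) * el s t = 1.
  have -> : 1 = el 1 0 by rewrite /el; ring.
  by rewrite elM; congr (el _ _); first (rewrite -[RHS]st1 /qnorm); ring.
apply/seteqP; split=> _ [w ->]; first by exists (w * el s t); rewrite mulrA.
exists (w * el s (- t)); rewrite mulrA -[w * _ * _]mulrA inv; ring.
Qed.

Lemma spanN x y : span (- x) (- y) = span x y.
Proof. by rewrite -(@span_unit (-1) 0 x y) //; congr (span _ _); ring. Qed.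

(** Among the generators with [x > 0] take one with the least [x].  Multiplying
    by [2 + S] or [2 - S] does not decrease [x], so [3 |y| <= x]; if [y < 0], one
    more multiplication by [2 + S] moves the generator into the domain. *)
Lemma reduced_generator x y : 0 < qnorm x y ->
  exists u v : int, [/\ 0 <= v, 2 * v < u, qnorm u v = qnorm x y & span u v = span x y].
Proof.
set n := qnorm x y => n_gt0.
pose P (k : nat) := `[< exists y', [/\ (0 < k)%N, qnorm k y' = n &
  span k y' = span x y] >].
have exP : exists k, P k.
  exists `|x|%N; apply/asboolP; have [x0|x0|x0] := ltrgt0P x.
  - by exists y; rewrite gez0_abs ?ltW //; split=> //; lia.
  - exists (- y); rewrite ltz0_abs // spanN; split=> //; first by lia.
    by rewrite /n /qnorm; ring.
  - by move: n_gt0; rewrite /n /qnorm x0; nia.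
case: (ex_minnP exP) => u /asboolP[v [u0 uvn uvE]] min_u.
have uv : 0 < u%:Z ^+ 2 - 3 * v ^+ 2 by rewrite -/(qnorm u v) uvn.
have step (t : int) : (t = 1 \/ t = -1) -> (u%:Z <= 2 * u%:Z + 3 * (t * v)).
  move=> tE; have t1 : qnorm 2 t = 1 by case: tE => ->.
  have pos : 0 < 2 * u%:Z + 3 * (t * v) by case: tE => ->; nia.
  have [u' u'E] : exists u' : nat, 2 * u%:Z + 3 * (t * v) = u' :> int.
    by exists (absz (2 * u%:Z + 3 * (t * v))); lia.
  rewrite u'E lez_nat; apply: min_u; apply/asboolP.
  exists (2 * v + t * u%:Z); split; first by lia.
    by rewrite -u'E qnormM t1 mul1r.
  by rewrite -u'E span_unit // uvE.
have := step 1 (or_introl erefl); have := step (-1) (or_intror erefl).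
move=> h1 h2; have [v0|v0] := leP 0 v; first by exists u%:Z, v; split=> //; lia.
exists (2 * u%:Z + 3 * (1 * v)), (2 * v + 1 * u%:Z); split; [lia|lia| |].
  by rewrite -uvn /qnorm; ring.
by rewrite span_unit.
Qed.

Definition reduced (x y : int) := (0 <= y) && (2 * y < x).

Lemma reduced_qnorm_gt0 x y : reduced x y -> 0 < qnorm x y.
Proof. by rewrite /reduced /qnorm => /andP[y0 yx]; nia. Qed.

(** If [t > 0] then also [s > 0], and [s^2 = 3 t^2 + 1] gives [s <= 2 t] and
    [3 t <= 2 s]; hence [2 v - u = x (2 t - s) + y (2 s - 3 t) >= 0] for the new
    coordinates [(u, v)], which are thus not reduced. *)
Lemma reduced_unit_le0 s t x y : qnorm s t = 1 -> reduced x y ->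
  reduced (s * x + 3 * (t * y)) (s * y + t * x) -> t <= 0.
Proof.
rewrite /reduced => st1 /andP[y0 yx] /andP[v0 vu]; rewrite leNgt; apply/negP => t0.
have stE : s * s = 3 * (t * t) + 1 by move: st1; rewrite /qnorm; lia.
have [s0|s0] := leP s 0.
  have h1 : - s * x < 3 * (t * y) by lia.
  have h2 : 3 * t < - 2 * s by nia.
  by nia.
have h1 : s <= 2 * t by nia.
have h2 : 3 * t <= 2 * s by nia.
have := mulr_ge0 (_ : 0 <= x) (_ : 0 <= 2 * t - s).
have := mulr_ge0 y0 (_ : 0 <= 2 * s - 3 * t).
by lia.
Qed.

(** Two reduced generators of an ideal differ by a unit [s + t S], of norm 1
    since both norms are positive.  The previous lemma, applied to the unit and
    to its inverse, gives [t = 0]. *)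
Lemma reduced_inj x y u v : reduced x y -> reduced u v ->
  span x y = span u v -> x = u /\ y = v.
Proof.
move=> rxy ruv E.
have /spanP[s [t [uE vE]]] : span x y (el u v) by rewrite E; exists 1; rewrite mul1r.
have /spanP[s' [t' [xE yE]]] : span u v (el x y).
  by rewrite -E; exists 1; rewrite mul1r.
have Nuv : qnorm u v = qnorm s t * qnorm x y by rewrite uE vE -qnormM.
have Nxy : qnorm x y = qnorm s' t' * qnorm u v by rewrite {1}xE {1}yE -qnormM.
have := reduced_qnorm_gt0 rxy; have := reduced_qnorm_gt0 ruv => uv0 xy0.
have st1 : qnorm s t = 1.
  move: uv0 xy0 Nuv Nxy; move: (qnorm u v) (qnorm x y) (qnorm s t) (qnorm s' t').
  move=> a b c d *; have c0 : 0 < c by nia.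
  have d0 : 0 < d by nia.
  have : a <= b by nia.
  by nia.
have st1' : qnorm s (- t) = 1 by rewrite -st1 /qnorm; ring.
have t0 : t <= 0 by apply: (@reduced_unit_le0 s t x y); rewrite -?uE -?vE.
have t0' : - t <= 0.
  apply: (@reduced_unit_le0 s (- t) u v) => //.
  have -> : s * u + 3 * (- t * v) = x.
    by transitivity (qnorm s t * x); [rewrite uE vE /qnorm; ring | rewrite st1 mul1r].
  have -> // : s * v + - t * u = y.
  by transitivity (qnorm s t * y); [rewrite uE vE /qnorm; ring | rewrite st1 mul1r].
have tE : t = 0 by lia.
rewrite tE in st1 uE vE; move: rxy ruv st1; rewrite /reduced /qnorm.
move=> /andP[y0 yx] /andP[v0 vu] st1.
have s1 : s = 1 by nia.
by rewrite uE vE s1; split; ring.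
Qed.

Definition hecke_exp (r d : nat) := (r * r.+1 + (d * (r.*2.+1 - d))./2)%N.

Definition hecke_ideal (r d : nat) := span (r.*2.+1 + d)%N d.

Lemma reduced_hecke (r d : nat) : (d < r.*2.+1)%N -> reduced (r.*2.+1 + d)%N d.
Proof. by rewrite /reduced => ltd; lia. Qed.

Lemma qnorm_hecke (r d : nat) : (d < r.*2.+1)%N ->
  qnorm (r.*2.+1 + d)%N d = (4 * hecke_exp r d).+1 :> int.
Proof.
move=> ltd; rewrite /hecke_exp.
have E : ((d * (r.*2.+1 - d))./2.*2 = d * (r.*2.+1 - d))%N.
  rewrite halfK oddM oddB 1?ltnW //= odd_double.
  by case: (odd d) => //=; rewrite subn0.
have : (4 * (r * r.+1 + (d * (r.*2.+1 - d))./2) =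
         4 * (r * r.+1) + 2 * (d * (r.*2.+1 - d)))%N.
  by rewrite -E; lia.
move=> ->; rewrite /qnorm; nia.
Qed.

Lemma hecke_ideal_norm (r d : nat) : (d < r.*2.+1)%N ->
  ideal_norm (hecke_ideal r d) = (4 * hecke_exp r d).+1.
Proof.
by move=> ltd; rewrite ideal_norm_span qnorm_hecke.
Qed.

Lemma hecke_ideal_neq0 (r d : nat) : (d < r.*2.+1)%N ->
  hecke_ideal r d <> [set 0].
Proof. by move=> ltd; apply: span_norm_neq0; rewrite qnorm_hecke. Qed.

Lemma hecke_ideal_inj (r d r' d' : nat) : (d < r.*2.+1)%N -> (d' < r'.*2.+1)%N ->
  hecke_ideal r d = hecke_ideal r' d' -> (r, d) = (r', d').
Proof.
move=> ltd ltd' /(reduced_inj (reduced_hecke ltd) (reduced_hecke ltd')) [h1 h2].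
by congr (_, _); lia.
Qed.

(** The norm form is never 3 modulo 4, so that it takes the value
    [ideal_norm I], and not its opposite, on a generator. *)
Lemma hecke_ideal_exists (I : set O) : is_ideal I -> I <> [set 0] ->
  ideal_norm I = 1 %[mod 4] ->
  exists r d : nat, (d < r.*2.+1)%N /\ I = hecke_ideal r d.
Proof.
move=> idI In0 nI; have [x [y [n0 IE]]] := ideal_principal idI In0.
move: nI; rewrite IE ideal_norm_span // => nI.
have n_gt0 : 0 < qnorm x y.
  rewrite lt_def n0 leNgt /=; apply/negP => nlt0.
  have [k kE] : exists k : int, qnorm x y = 4 * k + 3.
    exists (- (`|qnorm x y| %/ 4)%N%:Z - 1).
    have := divn_eq `|qnorm x y| 4; rewrite nI => E; lia.
  have [x1 [b xE]] : exists x1 (b : bool), x = 2 * x1 + b%:Z.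
    by exists (x %/ 2)%Z, (odd `|x|); lia.
  have [y1 [c yE]] : exists y1 (c : bool), y = 2 * y1 + c%:Z.
    by exists (y %/ 2)%Z, (odd `|y|); lia.
  by move: kE; rewrite /qnorm xE yE; case: b xE; case: c yE => *; lia.
have [u [v [v0 vu nE <-]]] := reduced_generator n_gt0.
have [v' vE] : exists v' : nat, v = v' :> int by exists `|v|%N; lia.
have [r rE] : exists r : nat, u = (r.*2.+1)%:Z + v.
  exists ((absz (u - v))./2).
  have : odd (absz (u - v)).
    have : odd `|qnorm x y|.
      by rewrite -(odd_double_half `|qnorm x y|); move: nI; lia.
    rewrite -nE.
    have -> : qnorm u v = (u - v) * (u + v) + 2 * (- (v * v)) by rewrite /qnorm; ring.
    by move: (v * v) => w; nia.
  by lia.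
exists r, v'; split; first by lia.
by rewrite /hecke_ideal; congr (span _ _); lia.
Qed.

End QuadraticRing.

(** * The ring of integers of Q(sqrt 3) *)

Lemma rat_sqr_neq3 (x : rat) : x ^+ 2 != 3.
Proof.
apply/eqP => x2; have := denq_neq0 x; rewrite (@sqr_eq3sqr (numq x) (denq x)) ?eqxx //.
apply: (@intr_inj rat); rewrite rmorphXn rmorphM rmorphXn /= numqE exprMn x2.
by [].
Qed.

(** Gauss's lemma. *)
Lemma monic_dvd_int (q : {poly rat}) (p : {poly int}) :
  q \is monic -> p \is monic -> q %| map_poly intr p ->
  exists q1 : {poly int}, q = map_poly intr q1.
Proof.
move=> qm pm /dvdpP_rat_int[p1 [a a0 qE] [r pE]].
have lead_p1r : lead_coef p1 * lead_coef r = 1 by rewrite -lead_coefM -pE (monicP pm).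
have lead_ap1 : a * (lead_coef p1)%:~R = 1.
  by rewrite -(lead_coef_map_inj (@intr_inj rat)) // -lead_coefZ -qE (monicP qm).
exists (lead_coef r *: p1); rewrite map_polyZ qE /=; congr (_ *: _).
by rewrite -[RHS]mul1r -[X in X * _]lead_ap1 -mulrA -intrM lead_p1r mulr1.
Qed.

Section RingOfIntegersQsqrt3.
Variables (L : fieldExtType rat) (s : L).
Hypotheses (s2 : s ^+ 2 = 3) (genL : <<1; s>>%VS = fullv).

Let elQ (a b : rat) : L := a%:A + b%:A * s.

Lemma elQ_eq0 a b : elQ a b = 0 -> a = 0 /\ b = 0.
Proof.
move=> E; have [b0|b0] := eqVneq b 0.
  split=> //; move: E; rewrite /elQ b0 scale0r mul0r addr0 => /eqP.
  by rewrite scaler_eq0 oner_eq0 orbF => /eqP.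
have /eqP[] := rat_sqr_neq3 (- a / b).
apply: (fmorph_inj (in_alg L)); rewrite rmorphXn rmorph_nat -s2 /=; congr (_ ^+ 2).
have /eqP := E; rewrite /elQ addr_eq0 => /eqP aE.
have bA : b%:A != 0 :> L by rewrite scaler_eq0 oner_eq0 orbF.
by rewrite -[LHS]/(in_alg L (- a / b)) fmorph_div rmorphN /= aE opprK mulrC mulKf.
Qed.

Lemma elQP z : exists a b, z = elQ a b.
Proof.
have : z \in <<1; s>>%VS by rewrite genL memvf.
move=> /Fadjoin1_polyP[p ->].
elim/poly_ind: p => [|p c [a [b E]]].
  by exists 0, 0; rewrite rmorph0 horner0 /elQ !scale0r mul0r addr0.
exists (3 * b + c), a; rewrite rmorphD rmorphM /= map_polyX map_polyC /=.
rewrite hornerMXaddC E /elQ scalerDl -scalerA.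
have -> : (3 : rat) *: (b%:A : L) = 3 * b%:A by rewrite scaler_nat mulr_natl.
by rewrite -s2; ring.
Qed.

Lemma elQ_root z a b : z = elQ a b ->
  z ^+ 2 - (2 * a)%:A * z + (a ^+ 2 - 3 * b ^+ 2)%:A = 0.
Proof.
move=> ->; rewrite /elQ.
rewrite -![_%:A]/(in_alg L _) !(rmorphB, rmorphXn, rmorphM, rmorph_nat).
by ring: s2.
Qed.

(** The trace and the norm of an algebraic integer are integers: by Gauss's
    lemma, the minimal polynomial of [z] is integral, being a divisor of the
    monic integral polynomial that [z] satisfies. *)
Lemma integral_coord z a b : is_integral z -> z = elQ a b ->
  exists u w : int, 2 * a = u%:~R /\ a ^+ 2 - 3 * b ^+ 2 = w%:~R.
Proof.
move=> /asboolP[p pm pz] zE.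
have {}pz : (map_poly (in_alg L) (map_poly intr p)).[z] = 0.
  rewrite -map_poly_comp (rootP _) //.
  by rewrite (eq_map_poly (g := intr)) // => i /=; rewrite -[LHS]/(in_alg L _) rmorph_int.
have [b0|b0] := eqVneq b 0.
  have zA : z = in_alg L a by rewrite zE /elQ b0 scale0r mul0r addr0.
  have : ('X - a%:P : {poly rat}) %| map_poly intr p.
    rewrite dvdp_XsubCl; apply/rootP; apply: (fmorph_inj (in_alg L)).
    by rewrite zA in pz; rewrite rmorph0 -horner_map pz.
  move=> /(monic_dvd_int (monicXsubC a) pm)[q1 qE].
  have := congr1 (fun q : {poly rat} => q`_0) qE.
  rewrite /= coefB coefX coefC coef_map sub0r => /(canRL (@opprK _)) ->.
  exists (2 * - q1`_0), (q1`_0 ^+ 2); rewrite b0; split; ring.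
pose m : {poly rat} := 'X^2 - (2 * a) *: 'X + (a ^+ 2 - 3 * b ^+ 2)%:P.
have mE : m = Poly [:: (a ^+ 2 - 3 * b ^+ 2); - (2 * a); 1].
  by rewrite /m /= !cons_poly_def; rewrite -!mul_polyC; ring.
have sm : size m = 3 by rewrite mE (@PolyK _ 0).
have mm : m \is monic by rewrite monicE lead_coefE sm mE (@PolyK _ 0).
have mz : (map_poly (in_alg L) m).[z] = 0.
  rewrite -[RHS](elQ_root zE) /m rmorphD rmorphB rmorphXn /= map_polyZ.
  by rewrite map_polyX map_polyC !hornerE.
have : m %| map_poly intr p.
  set P := map_poly intr p in pz *; rewrite /dvdp; apply/eqP.
  have ltr : (size (P %% m)%R < 3)%N by have := ltn_modpN0 P (monic_neq0 mm); rewrite sm.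
  rewrite (divp_eq P m) rmorphD rmorphM hornerD hornerM mz mulr0 add0r in pz.
  move: pz.
  move: (P %% m) ltr => r ltr.
  rewrite (@horner_coef_wide _ 2) ?size_map_poly // !big_ord_recl big_ord0.
  rewrite !coef_map /= => rz.
  have /elQ_eq0[cE /eqP] : elQ (r`_0 + r`_1 * a) (r`_1 * b) = 0.
    rewrite -[RHS]rz zE /elQ -![_%:A]/(in_alg L _) !(rmorphD, rmorphM).
    by rewrite /bump /=; ring.
  rewrite mulf_eq0 (negPf b0) orbF => /eqP r1.
  rewrite r1 mul0r addr0 in cE.
  apply/polyP => -[|[|i]]; rewrite coef0 ?cE ?r1 //.
  by apply: nth_default; apply: (@leq_trans 2).
move=> /(monic_dvd_int mm pm)[q1 qE].
have := congr1 (fun q : {poly rat} => q`_0) qE.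
have := congr1 (fun q : {poly rat} => q`_1) qE.
rewrite /= !coef_map mE !coef_Poly /= => E1 E0.
by exists (- q1`_1), q1`_0; rewrite mulrNz -E1 opprK.
Qed.

Lemma is_integral_sqrt3 : is_integral s.
Proof.
apply/asboolP; exists ('X^2 - 3%:P).
  by rewrite monicE lead_coefDl ?lead_coefXn // size_polyN size_polyXn size_polyC.
by apply/rootP; rewrite rmorphB rmorphXn /= map_polyX map_polyC !hornerE s2; ring.
Qed.

Definition int_sqrt3 : ring_of_integers L := RingOfIntegers is_integral_sqrt3.

Lemma int_sqrt3E : int_sqrt3 ^+ 2 = 3.
Proof. by apply: val_inj; rewrite rmorphXn rmorph_nat /= s2. Qed.

Let el (x y : int) : ring_of_integers L := x%:~R + y%:~R * int_sqrt3.

Lemma val_el x y : val (el x y) = elQ x%:~R y%:~R.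
Proof.
rewrite /el /elQ -![_%:A]/(in_alg L _) !rmorph_int rmorphD rmorphM !rmorph_int.
by [].
Qed.

Lemma int_sqrt3_inj x y u v : el x y = el u v -> x = u /\ y = v.
Proof.
move=> /(congr1 val); rewrite !val_el => /eqP; rewrite -subr_eq0 => /eqP E.
have /elQ_eq0[/eqP + /eqP] : elQ (x - u)%:~R (y - v)%:~R = 0.
  rewrite -E /elQ -![_%:A]/(in_alg L _) !rmorph_int.
  by rewrite !rmorphB /=; ring.
by rewrite !intr_eq0 !subr_eq0 => /eqP-> /eqP->.
Qed.

(** Let [z = a + b s].  The traces of [z] and [z s] show that [u = 2 a] and
    [v = 6 b] are integers, and the norm of [z] that [3 u^2 - v^2 = 12 w].  So 3
    divides [v = 3 k], and then [u^2 - 3 k^2 = 4 w] forces [u] and [k] to be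
    even. *)
Lemma ring_of_integersP (z : ring_of_integers L) : exists x y, z = el x y.
Proof.
have [a [b zE]] := elQP (val z).
have [u [w [uE wE]]] := integral_coord (valP z) zE.
have zsE : val (z * int_sqrt3) = elQ (3 * b) a.
  rewrite rmorphM /= [int_val z]zE /elQ -![_%:A]/(in_alg L _) rmorphM rmorph_nat.
  by ring: s2.
have [v [_ [vE _]]] := integral_coord (valP (z * int_sqrt3)) zsE.
have E : 3 * (u * u) - v * v = 12 * w.
  apply: (@intr_inj rat); rewrite rmorphB !rmorphM /= -uE -vE -wE; ring.
have [k [i [kE i0 i3]]] : exists k i : int, [/\ v = 3 * k + i, 0 <= i & i < 3].
  by exists (v %/ 3)%Z, (v %% 3)%Z; split; lia.
have i0E : i = 0.
  have : i = 0 \/ i = 1 \/ i = 2 by lia.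
  by case=> [//|[]] iE; move: E; rewrite kE iE; lia.
have {}E : u * u - 3 * (k * k) = 4 * w by move: E; rewrite kE i0E; lia.
have [x [c xE]] : exists x (c : bool), u = 2 * x + c%:Z.
  by exists (u %/ 2)%Z, (odd `|u|); lia.
have [y [d yE]] : exists y (d : bool), k = 2 * y + d%:Z.
  by exists (k %/ 2)%Z, (odd `|k|); lia.
have [cE dE] : c = false /\ d = false.
  by move: E; rewrite xE yE; case: (c); case: (d); lia.
have aE : a = x%:~R.
  by apply: (@mulfI _ 2) => //; rewrite uE xE cE addr0 rmorphM.
have bE : b = y%:~R.
  apply: (@mulfI _ 6) => //; transitivity (2 * (3 * b)); first by ring.
  by rewrite vE kE i0E yE dE !addr0 !rmorphM /=; ring.
by exists x, y; apply: val_inj; rewrite val_el zE aE bE.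
Qed.

End RingOfIntegersQsqrt3.

(** * Comparison of coefficients *)

Lemma fps_mulX (g : fps int) n :
  fps_mul (fps_of_poly 'X) g n = if n is k.+1 then g k else 0.
Proof.
rewrite (@fps_mul_trunc _ n.+2) // /fps_trunc; case: n => [|n].
  by rewrite coefM big_ord1 coef_poly /fps_of_poly coefX mul0r.
have -> : \poly_(i < n.+3) fps_of_poly 'X i = 'X :> {poly int}.
  apply/polyP=> i; rewrite coef_poly /fps_of_poly coefX.
  by case: i => [|[|i]] //; case: ifP.
by rewrite coefXM coef_poly /= ltnS (leq_trans _ (leqnSn _)).
Qed.

Definition hecke_pairs m : seq (nat * nat) :=
  [seq p <- [seq (r, d) | r <- iota 0 m.+1, d <- iota 0 r.*2.+1]
     | m == hecke_exp p.1 p.2].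

Lemma hecke_pairsP m r d :
  ((r, d) \in hecke_pairs m) = (d < r.*2.+1)%N && (m == hecke_exp r d).
Proof.
rewrite mem_filter [RHS]andbC; apply/andP/andP => -[/eqP mE].
  move=> /allpairsPdep[r' [d' [_ + [rE dE]]]]; rewrite -rE -dE mem_iota => ltd.
  by split=> //; apply/eqP.
move=> ltd; split; first by apply/eqP.
apply/allpairsPdep; exists r, d; rewrite !mem_iota; split=> //.
by rewrite add0n ltnS mE /hecke_exp; nia.
Qed.

Lemma f5_pairs m : f5 m = \sum_(p <- hecke_pairs m) 1.
Proof.
rewrite f5_coef big_filter [RHS]big_mkcond [RHS]big_allpairs_dep.
rewrite -[iota 0 m.+1]/(index_iota 0 m.+1) [RHS]big_mkord; apply: eq_bigr => r _.
rewrite -[iota 0 r.*2.+1]/(index_iota 0 r.*2.+1) [RHS]big_mkord; apply: eq_bigr => d _.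
by rewrite /hecke_exp; case: eqP.
Qed.

Theorem theorem1p5 (L : fieldExtType rat) (sqrt3 : L)
    (sqrt3E : sqrt3 ^+ 2 = 3) (genL : <<1; sqrt3>>%VS = fullv) :
  let ideals : set (set (ring_of_integers L)) :=
    [set a | [/\ is_ideal a, a <> [set 0] & ideal_norm a = 1 %[mod 4]]] in
  let q_norm (a : set (ring_of_integers L)) : fps int :=
    fps_of_poly 'X^(ideal_norm a) in
  fps_summable ideals q_norm /\
  fps_mul (fps_of_poly 'X) (fps_subst_expn 4 f5) = fps_sum ideals q_norm.
Proof.
move=> ideals q_norm.
have S2 := int_sqrt3E sqrt3E.
have elP := ring_of_integersP sqrt3E genL.
have el_inj := @int_sqrt3_inj _ _ sqrt3E.
pose phi (p : nat * nat) := hecke_ideal (int_sqrt3 sqrt3E) p.1 p.2.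
have q_normE a n : q_norm a n = (n == ideal_norm a)%:R.
  by rewrite /q_norm /fps_of_poly coefXn.
have phi_ideal r d : (d < r.*2.+1)%N ->
    ideals (phi (r, d)) /\ ideal_norm (phi (r, d)) = (4 * hecke_exp r d).+1.
  move=> ltd; have nE := hecke_ideal_norm S2 elP el_inj ltd.
  split=> //; split.
  - exact: span_ideal.
  - exact: (hecke_ideal_neq0 el_inj).
  - by rewrite nE -addn1 mulnC modnMDl.
have idealsP a n : ideals a -> n = ideal_norm a ->
    exists m, n = (4 * m).+1 /\ a \in [seq phi p | p <- hecke_pairs m].
  move=> [ida a0 na] ->.
  have [r [d [ltd aE]]] := hecke_ideal_exists S2 elP el_inj ida a0 na.
  exists (hecke_exp r d); rewrite aE; split; first exact: (phi_ideal r d ltd).2.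
  by apply/mapP; exists (r, d); rewrite // hecke_pairsP ltd eqxx.
split=> [n|].
  suff sub : ideals `&` [set i | q_norm i n != 0] `<=`
      [set` [seq phi p | p <- hecke_pairs (n %/ 4)%N]].
    exact: sub_finite_set sub (finite_seq _).
  move=> a [Ia] /=; rewrite q_normE; case: (n =P _) => // nE _.
  have [m [mE]] := idealsP a n Ia nE.
  by have -> : (n %/ 4 = m)%N by lia.
apply/funext => n; rewrite fps_mulX /fps_sum.
have [[m nE]|nN] := pselect (exists m, n = (4 * m).+1); last first.
  rewrite fsbig1 => [|a Ia]; last first.
    by rewrite q_normE; case: eqP => // /(idealsP a n Ia)[m [nE _]]; case: nN; exists m.
  case: n nN => // k kN; rewrite /fps_subst_expn; case: ifP => // /dvdnP[m kE].
  by case: kN; exists m; rewrite kE mulnC.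
rewrite nE /fps_subst_expn dvdn_mulr // mulKn // f5_pairs.
rewrite (@fsbigE _ _ _ _ _ [seq phi p | p <- hecke_pairs m]).
- rewrite big_map big_seq [RHS]big_seq_cond; apply: congr_big => // -[r d].
    rewrite hecke_pairsP; case: ltnP => //= ltd.
    by rewrite (mem_set (phi_ideal r d ltd).1) andbT.
  rewrite hecke_pairsP => /andP[ltd /eqP->].
  by rewrite q_normE (phi_ideal r d ltd).2 eqxx.
- rewrite map_inj_in_uniq; last first.
    move=> [r d] [r' d']; rewrite !hecke_pairsP => /andP[ltd _] /andP[ltd' _].
    exact: (hecke_ideal_inj S2 elP el_inj).
  rewrite filter_uniq // allpairs_uniq_dep ?iota_uniq // => [r _|].
    exact: iota_uniq.
  by move=> [r d] [r' d'] _ _ []->->.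
- move=> _ /mapP[[r d] + ->]; rewrite hecke_pairsP => /andP[ltd _].
  exact: (phi_ideal r d ltd).1.
move=> a Ia; rewrite q_normE; case: eqP => // /(idealsP a _ Ia)[m' [mE +]].
have -> : m' = m by lia.
by move=> ->.
Qed.
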